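(* Let $k\geqslant 0$ and $m\geqslant 0$ be integers and let $i\in\{0,1,2,\dots\}\cup\{\infty\}$. Let $C$ and $C'$ be any two components of type $\overline{*i}$, i.e. each of $C$, $C'$ has Grundy-value $i$ and has a bulb as its leftmost piece (except that, if $i=0$, it is the empty component). Then $$\mathcal{G}(\overline{k}\,|m|\,C)=\mathcal{G}(\overline{k}\,|m|\,C').$$ In other words, the Grundy-value of $\overline{k}\,|m|\,\overline{*i}$ does not depend on the shape of $\overline{*i}$.
   Context: The ruleset CHRISTMAS LIGHTS' FIXTURE. A component is a finite (possibly empty) word, read from left to right, in two kinds of pieces: bulbs and sockets. The ruleset is impartial; the moves available in a component are: (1) choose a bulb: that bulb and every piece to its right are deleted (a quiet move); (2) choose a socket that does not have bulbs as both its left and right neighbours (either neighbour is a socket or does not exist): only that socket is deleted and the two ends are joined (a quiet move); (3) choose a socket whose left and right neighbours both exist and are bulbs: only that socket is deleted, the two ends are joined, and the same player must move again, in any component of the current disjunctive sum (a carry-on move). A player who has to move and has no move loses (normal play). A disjunctive sum of components (and nim heaps) is played by moving in exactly one summand at each move, with players alternating except for carry-on moves. A $\mathcal P$-position is one that the previous player (the one not about to move) wins; an $\mathcal N$-position is one that the next player wins. Grundy-value. $\mathcal{G}(G)\in\{0,1,2,\dots\}\cup\{\infty\}$ is defined recursively. Let $S_G$ be the set of all finite Grundy-values of components reachable from $G$ by one quiet move. Let $P_G$ be the set of nonnegative integers $j$ such that some carry-on move leads from $G$ to a component $G'$ with $\mathcal{G}(G')\neq j$ (so $\mathcal G(G')=\infty$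 protects every $j$). Then $\mathcal{G}(G)=\operatorname{mex}(S_G\cup P_G)$, the least nonnegative integer not in $S_G\cup P_G$, and $\mathcal{G}(G)=\infty$ if $S_G\cup P_G$ contains all nonnegative integers. Equivalently, $\mathcal{G}(G)=n<\infty$ iff the sum of $G$ and a nim heap $*n$ of size $n$ is a $\mathcal P$-position, and $\mathcal{G}(G)=\infty$ iff there is no such $n$. Notation: $\overline{n}$ is a string of $n$ consecutive bulbs, $|m|$ is a string of $m$ consecutive sockets, and juxtaposition is concatenation from left to right. For $0\leqslant i\leqslant\infty$, $\overline{*i}$ designates any component with Grundy-value $i$ whose leftmost piece is a bulb, except that for $i=0$ it designates the empty component. *)

(* Defs.v *)
(* MathComp world; the mex of an arbitrary set of integers uses the classical
   decidability of MathComp-Analysis' boolp. *)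
From mathcomp Require Import all_boot.
From mathcomp Require Import boolp.

Set Implicit Arguments.
Unset Strict Implicit.
Unset Printing Implicit Defensive.

Inductive piece := bulb | socket.

Definition component := seq piece.

(* In both socket rules, [s] is what lies to the left of the socket and [t]
   what lies to its right. The default [socket] of [last] and [head] makes a
   missing neighbour count as "not a bulb". *)
Definition between_bulbs (s t : component) : Prop :=
  last socket s = bulb /\ head socket t = bulb.

Inductive quiet_move : component -> component -> Prop :=
| quiet_bulb (s t : component) : quiet_move (s ++ bulb :: t) s
| quiet_socket (s t : component) :
    ~ between_bulbs s t -> quiet_move (s ++ socket :: t) (s ++ t).

Inductive carry_on_move : component -> component -> Prop :=
| carry_on_socket (s t : component) :
    between_bulbs s t -> carry_on_move (s ++ socket :: t) (s ++ t).

(* Values in {0, 1, 2, ...} together with infinity, which is [None]. *)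
Definition value := option nat.

Definition mex (A : nat -> Prop) : value :=
  if pselect (exists n, ~~ `[< A n >]) is left exA
  then Some (ex_minn exA) else None.

Lemma mex_SomeP (A : nat -> Prop) (n : nat) :
  mex A = Some n <-> ~ A n /\ (forall j, j < n -> A j).
Proof.
rewrite /mex; case: pselect => [exA|nexA].
  case: ex_minnP => p nAp' pmin; have nAp := elimT (asboolPn _) nAp'.
  split=> [[<-]|[nAn Alt]].
    split=> // j ltjp; apply: contrapT => nAj.
    by have /pmin := introT (asboolPn _) nAj; rewrite leqNgt ltjp.
  congr Some; apply/eqP; rewrite eqn_leq pmin ?(introT (asboolPn _)) //.
  by rewrite leqNgt; apply/negP => /Alt.
by split=> // -[nAn _]; case: nexA; exists n; apply: introT nAn; exact: asboolPn.
Qed.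

Lemma mex_NoneP (A : nat -> Prop) : mex A = None <-> (forall n, A n).
Proof.
rewrite /mex; case: pselect => [exA|nexA].
  by split=> // AT; case: exA => n nAn; case: (elimT (asboolPn _) nAn).
split=> // _ n; apply: contrapT => nAn.
by apply: nexA; exists n; apply: introT nAn; exact: asboolPn.
Qed.

(* S_G and P_G, for a given assignment [g] of values to the options of G. *)
Definition quiet_values (g : component -> value) (G : component) (j : nat) :=
  exists2 H, quiet_move G H & g H = Some j.

Definition protected_values (g : component -> value) (G : component) (j : nat) :=
  exists2 H, carry_on_move G H & g H <> Some j.

(* Every move shortens the word, so [size G] rounds of recursion suffice;
   [grundyE] is the defining equation. *)
Fixpoint grundy_rec (n : nat) (G : component) : value :=
  if n is n'.+1 then
    mex (fun j => quiet_values (grundy_rec n') G j \/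
                  protected_values (grundy_rec n') G j)
  else Some 0.

Definition grundy (G : component) : value := grundy_rec (size G) G.

Lemma quiet_move_size (G H : component) : quiet_move G H -> size H < size G.
Proof. by case=> s t *; rewrite !size_cat /= addnS ltnS ?leq_addr. Qed.

Lemma carry_on_move_size (G H : component) :
  carry_on_move G H -> size H < size G.
Proof. by case=> s t *; rewrite !size_cat /= addnS. Qed.

Lemma eq_mex_options (f g : component -> value) (G : component) :
    (forall H, size H < size G -> f H = g H) ->
  mex (fun j => quiet_values f G j \/ protected_values f G j) =
  mex (fun j => quiet_values g G j \/ protected_values g G j).
Proof.
move=> eqfg; congr mex; apply: funext => j; apply: propext.
split=> -[] [H mv vH]; [left|right|left|right]; exists H => //.
- by rewrite -eqfg //; exact: quiet_move_size.
- by rewrite -eqfg //; exact: carry_on_move_size.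
- by rewrite eqfg //; exact: quiet_move_size.
- by rewrite eqfg //; exact: carry_on_move_size.
Qed.

Lemma grundy_rec_enough (n : nat) (G : component) :
  size G <= n -> grundy_rec n G = grundy G.
Proof.
elim/ltn_ind: n G => -[_ [|//]//|n IHn] G leGn.
rewrite /grundy; case: G leGn => [_|p G leGn] /=.
  apply/mex_SomeP; split=> // -[] [H].
    by move=> /quiet_move_size.
  by move=> /carry_on_move_size.
apply: eq_mex_options => H ltH.
have leHG : size H <= size G by [].
by rewrite (IHn n) ?(IHn (size G)) // (leq_trans leHG).
Qed.

Lemma grundyE (G : component) :
  grundy G =
  mex (fun j => quiet_values grundy G j \/ protected_values grundy G j).
Proof.
rewrite -(@grundy_rec_enough (size G).+1) //=.
by apply: eq_mex_options => H ltH; rewrite grundy_rec_enough // ltnW.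
Qed.

Definition bulbs (k : nat) : component := nseq k bulb.
Definition sockets (m : nat) : component := nseq m socket.

(* The components designated by an overlined *i. *)
Definition star_type (i : value) (C : component) : Prop :=
  grundy C = i /\
  (if i is Some 0 then C = [::] else exists t, C = bulb :: t).

(* Main.v *)
(* Write [W C] for a word [W] followed by a component [C] that is empty or
   starts with a bulb. If no socket of [W] is between bulbs, then every move of
   [W C] inside [W] is quiet, and, by induction on [C], the value of [W C]
   depends only on that of [C] as soon as this holds for the words obtained
   from [W] by deleting a socket: the map [i |-> G(W \bar{i})] is injective, so
   the options of [C] with values larger than that of [C] have no influence.
   This covers all prefixes [\bar{k} |m|] except [m = 1], [k > 0], where the
   carry-on move to [\bar{k} C] forces the value to be [k + i] for [2 <= i] and
   infinity for [i = 1]. *)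
Require Import Defs.
From mathcomp Require Import all_boot.
From mathcomp Require Import boolp zify.

(** * Values in terms of options; bounds by size *)

Definition option_value (G : component) (j : nat) : Prop :=
  quiet_values grundy G j \/ protected_values grundy G j.

Lemma grundy_SomeP (G : component) (n : nat) :
  grundy G = Some n <->
  ~ option_value G n /\ (forall j, j < n -> option_value G j).
Proof. by rewrite grundyE mex_SomeP. Qed.

Lemma grundy_NoneP (G : component) :
  grundy G = None <-> (forall n, option_value G n).
Proof. by rewrite grundyE mex_NoneP. Qed.

Lemma quiet_grundy_neq (G H : component) (n : nat) :
  grundy G = Some n -> quiet_move G H -> grundy H <> Some n.
Proof. by move=> /grundy_SomeP[nopt _] mv vH; apply: nopt; left; exists H. Qed.

(** Otherwise the option would protect [n] itself, putting [n] in the set whose mex is [n]. *)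
Lemma carry_on_grundy_eq (G H : component) (n : nat) :
  grundy G = Some n -> carry_on_move G H -> grundy H = Some n.
Proof.
move=> /grundy_SomeP[nopt _] mv; apply: contrapT => vH.
by apply: nopt; right; exists H.
Qed.

(** If [n] exceeded [size G], then [size G] would have to be a quiet or protected value. Either way
    a strictly shorter option has a value larger than its own size: the value [size G] after a quiet
    move, [n] after a carry-on move. *)
Lemma grundy_le_size (G : component) (n : nat) :
  grundy G = Some n -> n <= size G.
Proof.
move: {2}(size G) (leqnn (size G)) => N.
elim: N G n => [|N IH] G n leG vG; rewrite leqNgt; apply/negP => ltn;
  have [_ /(_ _ ltn) [[H mv vH]|[H mv _]]] := (grundy_SomeP _ _).1 vG.
- by have := quiet_move_size mv; lia.
- by have := carry_on_move_size mv; lia.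
- have ltH := quiet_move_size mv.
  by have := IH H _ ltac:(lia) vH; lia.
- have ltH := carry_on_move_size mv.
  by have := IH H _ ltac:(lia) (carry_on_grundy_eq _ _ _ vG mv); lia.
Qed.

(** An infinite value would now require a quiet option of value [size G], more than that option's
    size. *)
Lemma grundy_finite (G : component) :
  (forall H, ~ carry_on_move G H) -> exists n, grundy G = Some n.
Proof.
case vG: (grundy G) => [n|] noco; first by exists n.
have [[H mv /grundy_le_size]|[H /noco//]] := (grundy_NoneP _).1 vG (size G).
by have := quiet_move_size mv; lia.
Qed.

(** * Moves in a concatenation *)

Lemma cat_cons_eq_cat {T : Type} {x : T} {s t W C : seq T} :
    s ++ x :: t = W ++ C ->
  (exists2 t', W = s ++ x :: t' & t = t' ++ C) \/
  (exists2 s', s = W ++ s' & C = s' ++ x :: t).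
Proof.
elim: W s => [|y W IH] [|z s] /=; try by right; eexists.
  by case=> <- ->; left; exists W.
case=> -> /IH[[t' -> ->]|[s' -> ->]]; first by left; exists t'.
by right; exists s'.
Qed.

(** The default [bulb] admits the empty component. Unlike [star_type], this condition is inherited
    by all options, as the inductions on the tail require. *)
Definition no_head_socket (C : component) : Prop := head bulb C = bulb.

Lemma no_head_socketP (C : component) :
  no_head_socket C -> C = [::] \/ exists C', C = bulb :: C'.
Proof. by case: C => [|x C hC]; [left|right; exists C; rewrite -hC]. Qed.

Lemma no_head_socket_bulbs (k : nat) : no_head_socket (bulbs k).
Proof. by case: k. Qed.

Lemma no_head_socket_catl (s t : component) (x : piece) :
  no_head_socket (s ++ x :: t) -> no_head_socket s.
Proof. by case: s. Qed.

Lemma no_head_socket_remove (s t : component) :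
  no_head_socket (s ++ socket :: t) -> no_head_socket (s ++ t).
Proof. by case: s. Qed.

Lemma no_head_socket_quiet (C H : component) :
  quiet_move C H -> no_head_socket C -> no_head_socket H.
Proof.
by case=> [s t|s t _]; [exact: no_head_socket_catl|exact: no_head_socket_remove].
Qed.

Lemma no_head_socket_carry_on (C H : component) :
  carry_on_move C H -> no_head_socket C -> no_head_socket H.
Proof. by case=> s t _; exact: no_head_socket_remove. Qed.

(** The hypothesis forces [s] to be nonempty, so the left neighbour of the socket lies in [s] and is
    not affected by [W]. *)
Lemma between_bulbs_catl (W s t : component) :
  no_head_socket (s ++ socket :: t) ->
  between_bulbs (W ++ s) t <-> between_bulbs s t.
Proof. by case: s => // x s _; rewrite /between_bulbs last_cat. Qed.

Lemma quiet_move_catl (W C H : component) :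
  no_head_socket C -> quiet_move C H -> quiet_move (W ++ C) (W ++ H).
Proof.
move=> hC mv; case: mv hC => [s t|s t nb] hC; rewrite !catA.
  exact: quiet_bulb.
by apply: quiet_socket => /(between_bulbs_catl W s t hC).
Qed.

Lemma carry_on_move_catl (W C H : component) :
  no_head_socket C -> carry_on_move C H -> carry_on_move (W ++ C) (W ++ H).
Proof.
move=> hC mv; case: mv hC => s t nb hC; rewrite !catA.
by apply: carry_on_socket; apply/(between_bulbs_catl W s t hC).
Qed.

Variant quiet_cat_spec (W C : component) : component -> Prop :=
| QuietLeftBulb s t of W = s ++ bulb :: t : quiet_cat_spec W C s
| QuietLeftSocket s t of W = s ++ socket :: t & ~ between_bulbs s (t ++ C) :
    quiet_cat_spec W C (s ++ t ++ C)
| QuietRight H of quiet_move C H : quiet_cat_spec W C (W ++ H).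

Lemma quiet_move_catP (W C H : component) :
  no_head_socket C -> quiet_move (W ++ C) H -> quiet_cat_spec W C H.
Proof.
move=> hC; move: {-2}(W ++ C) (erefl (W ++ C)) => G eG mv.
case: mv eG => [s t|s t nb] /cat_cons_eq_cat[[t' eW et]|[s' es eC]].
- exact: QuietLeftBulb eW.
- by rewrite es; apply: QuietRight; rewrite eC; apply: quiet_bulb.
- by rewrite et in nb *; exact: QuietLeftSocket eW nb.
- rewrite es -catA; apply: QuietRight; rewrite es in nb.
  rewrite eC; apply: quiet_socket => bb; apply: nb.
  by apply/between_bulbs_catl; rewrite -?eC.
Qed.

Variant carry_on_cat_spec (W C : component) : component -> Prop :=
| CarryOnLeft s t of W = s ++ socket :: t & between_bulbs s (t ++ C) :
    carry_on_cat_spec W C (s ++ t ++ C)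
| CarryOnRight H of carry_on_move C H : carry_on_cat_spec W C (W ++ H).

Lemma carry_on_move_catP (W C H : component) :
  no_head_socket C -> carry_on_move (W ++ C) H -> carry_on_cat_spec W C H.
Proof.
move=> hC; move: {-2}(W ++ C) (erefl (W ++ C)) => G eG mv.
case: mv eG => s t nb /cat_cons_eq_cat[[t' eW et]|[s' es eC]].
- by rewrite et in nb *; exact: CarryOnLeft eW nb.
- rewrite es -catA; apply: CarryOnRight; rewrite es in nb.
  rewrite eC; apply: carry_on_socket.
  by apply/(between_bulbs_catl W); rewrite -?eC.
Qed.

(** * Strings of bulbs, which behave as nim heaps *)

Lemma bulbsD (j k : nat) : bulbs (j + k) = bulbs j ++ bulbs k.
Proof. exact: nseqD. Qed.

Lemma bulbs_eq_cat_cons (k : nat) (s t : component) (x : piece) :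
  bulbs k = s ++ x :: t -> [/\ x = bulb, s = bulbs (size s) & size s < k].
Proof.
elim: k s => [|k IH] [|y s] //=; first by case=> <-.
by case=> <- /IH[-> es lt]; split=> //=; rewrite {1}es.
Qed.

Lemma quiet_move_bulbsP (k : nat) (H : component) :
  quiet_move (bulbs k) H <-> exists2 j, j < k & H = bulbs j.
Proof.
split.
  move: {-1}(bulbs k) (erefl (bulbs k)) => G eG mv; case: mv eG => s t.
    by move=> /bulbs_eq_cat_cons[_ es lt]; exists (size s).
  by move=> _ /bulbs_eq_cat_cons[].
case=> j ltjk ->; rewrite -(subnKC ltjk) addSn -addnS bulbsD.
exact: quiet_bulb.
Qed.

Lemma carry_on_move_bulbs (k : nat) (H : component) :
  ~ carry_on_move (bulbs k) H.
Proof.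
move: {-1}(bulbs k) (erefl (bulbs k)) => G eG mv; case: mv eG => s t _.
by case/bulbs_eq_cat_cons.
Qed.

Lemma grundy_bulbs (k : nat) : grundy (bulbs k) = Some k.
Proof.
elim/ltn_ind: k => k IH; apply/grundy_SomeP; split.
  case=> [[H /quiet_move_bulbsP[j ltjk ->]]|[H /carry_on_move_bulbs//]].
  by rewrite IH // => -[ejk]; rewrite ejk ltnn in ltjk.
move=> j ltjk; left; exists (bulbs j); last exact: IH.
by apply/quiet_move_bulbsP; exists j.
Qed.

(** Choosing the leftmost bulb leaves the empty component, of value 0. *)
Lemma grundy_bulb_cons_neq0 (C : component) : grundy (bulb :: C) <> Some 0.
Proof.
have mv : quiet_move (bulb :: C) [::] := quiet_bulb [::] C.
move=> /quiet_grundy_neq /(_ mv); apply; exact: (grundy_bulbs 0).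
Qed.

(* [\bar{i}] serves as the canonical component of value [i]. *)
Definition depends_on_value (W : component) : Prop :=
  forall C i, no_head_socket C -> grundy C = Some i ->
  grundy (W ++ C) = grundy (W ++ bulbs i).

Definition preserves_infinity (W : component) : Prop :=
  forall C, no_head_socket C -> grundy C = None -> grundy (W ++ C) = None.

Definition quiet_sockets (W : component) : Prop :=
  forall s t, W = s ++ socket :: t ->
  forall C, no_head_socket C -> ~ between_bulbs s (t ++ C).

(** * Prefixes all of whose sockets are quiet *)

Section QuietPrefix.

Variable W : component.
Hypothesis quietW : quiet_sockets W.
Hypothesis dependsW :
  forall s t, W = s ++ socket :: t -> depends_on_value (s ++ t).

Lemma grundy_cat_bulbs_finite (i : nat) :
  exists n, grundy (W ++ bulbs i) = Some n.
Proof.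
apply: grundy_finite => H mv.
case: (carry_on_move_catP _ _ _ (no_head_socket_bulbs i) mv) => [s t eW|H'].
  exact: quietW eW _ (no_head_socket_bulbs i).
exact: carry_on_move_bulbs.
Qed.

(** For [i < j], the word with tail [bulbs i] is a quiet option of the one with tail [bulbs j],
    whose value is finite. *)
Lemma grundy_cat_bulbs_inj : injective (fun i => grundy (W ++ bulbs i)).
Proof.
have neq i j : i < j -> grundy (W ++ bulbs i) <> grundy (W ++ bulbs j).
  move=> ltij; have [n vj] := grundy_cat_bulbs_finite j; rewrite vj.
  apply: quiet_grundy_neq vj _; apply: quiet_move_catl.
    exact: no_head_socket_bulbs.
  by apply/quiet_move_bulbsP; exists i.
by move=> i j /= eij; case: (ltngtP i j) => // /neq; rewrite eij.
Qed.

(** Finite and infinite values are treated together because options of a tail of either sort may be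
    of the other sort. *)
Lemma quiet_prefix_value (C : component) :
    no_head_socket C ->
  grundy (W ++ C) =
  if grundy C is Some i then grundy (W ++ bulbs i) else None.
Proof.
move: {2}(size C).+1 (ltnSn (size C)) => N.
elim: N C => // N IH C leC hC.
have IHq H : quiet_move C H -> grundy (W ++ H) =
    if grundy H is Some i then grundy (W ++ bulbs i) else None.
  move=> mv; apply: IH; last exact: no_head_socket_quiet mv hC.
  by have := quiet_move_size mv; lia.
have IHc H : carry_on_move C H -> grundy (W ++ H) =
    if grundy H is Some i then grundy (W ++ bulbs i) else None.
  move=> mv; apply: IH; last exact: no_head_socket_carry_on mv hC.
  by have := carry_on_move_size mv; lia.
case vC: (grundy C) => [i|].
  have hi := no_head_socket_bulbs i.
  have [f vf] := grundy_cat_bulbs_finite i; rewrite vf.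
  have noncarry H : carry_on_move C H -> grundy (W ++ H) = Some f.
    by move=> mv; rewrite IHc // (carry_on_grundy_eq _ _ _ vC mv).
  have [_ optf] := (grundy_SomeP _ _).1 vf.
  apply/grundy_SomeP; split=> [[] [G]|].
  - case/(quiet_move_catP _ _ _ hC) => [s t eW|s t eW _|H mv].
    + apply: (quiet_grundy_neq _ _ _ vf); rewrite eW -catA; exact: quiet_bulb.
    + rewrite catA (dependsW _ _ eW _ _ hC vC).
      apply: (quiet_grundy_neq _ _ _ vf); rewrite {1}eW -!catA.
      exact: quiet_socket (quietW _ _ eW _ hi).
    (* The value of [H] may exceed [i]; it only has to differ from [i], and injectivity then keeps
       the value of [W ++ H] away from [f]. *)
    + rewrite IHq //; case vH: (grundy H) => [j|] //.
      rewrite -vf => /grundy_cat_bulbs_inj ji; rewrite ji in vH.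
      exact: quiet_grundy_neq vC mv vH.
  - case/(carry_on_move_catP _ _ _ hC) => [s t eW|H mv].
      by move=> /(quietW _ _ eW _ hC).
    by rewrite noncarry.
  move=> j ltjf; have [[G mv vG]|[G mv _]] := optf _ ltjf.
    case: (quiet_move_catP _ _ _ hi mv) vG => [s t eW|s t eW _|H] {mv}.
    + by move=> vs; left; exists s => //; rewrite eW -catA; exact: quiet_bulb.
    + move=> vst; left; exists (s ++ t ++ C).
        rewrite {1}eW -!catA; exact: quiet_socket (quietW _ _ eW _ hC).
      by rewrite catA (dependsW _ _ eW _ _ hC vC) -catA.
    (* As [a < i], either [C] has a quiet option of value [a], or it has a carry-on move; the latter
       leads to the value [f] after [W], which protects [j < f]. *)
    + case/quiet_move_bulbsP => a ltai -> vj.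
      have [_ /(_ _ ltai) [[H' mv vH']|[H' mv _]]] := (grundy_SomeP _ _).1 vC.
        left; exists (W ++ H'); first exact: quiet_move_catl.
        by rewrite IHq // vH'.
      right; exists (W ++ H'); first exact: carry_on_move_catl.
      by rewrite noncarry // => -[efj]; rewrite efj ltnn in ltjf.
  case: (carry_on_move_catP _ _ _ hi mv) => [s t eW|H /carry_on_move_bulbs//].
  by move=> /(quietW _ _ eW _ hi).
(* If [j] were missing, every carry-on option of [C] would give [j] after [W]. One exists, and its
   value [a] is finite. Since [a] is a quiet or protected value of [C], either a quiet option also
   gives [j], or another carry-on option of value other than [a] does, against injectivity. *)
apply/grundy_NoneP => j; apply: contrapT => noptj.
have carry_j H : carry_on_move C H -> grundy (W ++ H) = Some j.
  move=> mv; apply: contrapT => neq; apply: noptj; right.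
  by exists (W ++ H) => //; exact: carry_on_move_catl.
have [H mvH] : exists H, carry_on_move C H.
  by apply: contrapT => /forallNP /grundy_finite[n]; rewrite vC.
have := carry_j _ mvH; rewrite IHc //; case vH: (grundy H) => [a|] // va.
have [[H' mv vH']|[H' mv vH']] := (grundy_NoneP _).1 vC a.
  apply: noptj; left; exists (W ++ H'); first exact: quiet_move_catl.
  by rewrite IHq // vH'.
have := carry_j _ mv; rewrite IHc //; case vH'b: (grundy H') => [b|] //.
by rewrite -va => /grundy_cat_bulbs_inj eba; apply: vH'; rewrite vH'b eba.
Qed.

Lemma quiet_prefix : depends_on_value W /\ preserves_infinity W.
Proof.
by split=> [C i hC vC|C hC vC]; rewrite (quiet_prefix_value C hC) vC.
Qed.

End QuietPrefix.

(** * Prefixes of bulbs followed by sockets *)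

Lemma socketsD (a b : nat) : sockets (a + b) = sockets a ++ sockets b.
Proof. exact: nseqD. Qed.

Lemma bulbs_sockets_eq_cat (k m : nat) (s t : component) :
    bulbs k ++ sockets m = s ++ socket :: t ->
  exists a b, [/\ s = bulbs k ++ sockets a, t = sockets b & m = a + b.+1].
Proof.
elim: k s => [|k IH] [|x s] //=; first by case: m => // m [<-]; exists 0, m.
  elim: m x s => // m IH x [|y s] /= [<-].
    by case: m {IH} => // m [<-]; exists 1, m.
  by move=> /IH[a [b [-> -> ->]]]; exists a.+1, b.
by case=> <- /IH[a [b [-> -> ->]]]; exists a, b.
Qed.

(** Each socket either has another socket beside it or is a lone one with nothing to its left. *)
Lemma quiet_sockets_bulbs_sockets (k m : nat) :
  (k == 0) || (m != 1) -> quiet_sockets (bulbs k ++ sockets m).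
Proof.
move=> km s t /bulbs_sockets_eq_cat[a [b [-> -> em]]] C _ [].
case: a em => [|a] em.
  case: b em => [|b] em //; case: k km => [|k] //.
  by rewrite em.
rewrite last_cat /= (_ : last socket (sockets a) = socket) //.
by elim: (a).
Qed.

Lemma bulbs_prefix (k : nat) :
  depends_on_value (bulbs k) /\ preserves_infinity (bulbs k).
Proof.
have noS s t : bulbs k <> s ++ socket :: t by case/bulbs_eq_cat_cons.
by apply: quiet_prefix => s t /noS.
Qed.

Lemma grundy_bulbs_cat (k i : nat) (C : component) :
  no_head_socket C -> grundy C = Some i -> grundy (bulbs k ++ C) = Some (k + i).
Proof.
by move=> hC vC; rewrite ((bulbs_prefix k).1 C i) // -bulbsD grundy_bulbs.
Qed.

(** The final socket lacks a right neighbour, so its removal is quiet; the options are exactly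
    [bulbs j] for [j <= k]. *)
Lemma grundy_bulbs_socket (k : nat) : grundy (bulbs k ++ [:: socket]) = Some k.+1.
Proof.
apply/grundy_SomeP; split=> [[] [G]|j].
- move: {-1}(bulbs k ++ _) (erefl (bulbs k ++ [:: socket])) => U eU mv.
  case: mv eU => [s t /esym/cat_cons_eq_cat|s t _ /(bulbs_sockets_eq_cat k 1)].
    case=> [[t' eW _]|[[|x s'] _ //]]; last by case: s'.
    have [_ es lt] := bulbs_eq_cat_cons _ _ _ _ eW.
    by rewrite es grundy_bulbs => -[]; lia.
  case=> a [b [-> -> em]]; have [-> ->] : a = 0 /\ b = 0 by lia.
  by rewrite !cats0 grundy_bulbs => -[]; lia.
- move: {-1}(bulbs k ++ _) (erefl (bulbs k ++ [:: socket])) => U eU mv.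
  case: mv eU => s t bb /(bulbs_sockets_eq_cat k 1).
  case=> [a [[|b] [_ et em]]]; last lia.
  by case: bb; rewrite et.
rewrite ltnS leq_eqVlt => /orP[/eqP->|ltjk]; left.
  exists (bulbs k); last exact: grundy_bulbs.
  have nb : ~ between_bulbs (bulbs k) [::] by case.
  by have := quiet_socket nb; rewrite cats0.
exists (bulbs j); last exact: grundy_bulbs.
rewrite -(subnKC ltjk) addSn -addnS bulbsD -catA; exact: quiet_bulb.
Qed.

(** * The exceptional prefixes: at least one bulb, then a single socket *)

Section SingleSocket.

Variable k : nat.

Local Notation W := (bulbs k.+1 ++ [:: socket]).

Lemma remove_single_socket (C : component) :
  carry_on_move (W ++ bulb :: C) (bulbs k.+1 ++ bulb :: C).
Proof.
rewrite -catA; apply: carry_on_socket; split=> //.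
by rewrite -addn1 bulbsD last_cat.
Qed.

Lemma single_socket_infinity (C : component) :
  grundy (bulb :: C) = None -> grundy (W ++ bulb :: C) = None.
Proof.
move=> vC; apply/grundy_NoneP => j; right.
exists (bulbs k.+1 ++ bulb :: C); first exact: remove_single_socket.
by rewrite (bulbs_prefix k.+1).2.
Qed.

(** Removing the socket carries on to value [k.+2], protecting everything else; [k.+2] itself is the
    value of [W], left by choosing the first bulb of the tail. *)
Lemma single_socket_one (C : component) :
  grundy (bulb :: C) = Some 1 -> grundy (W ++ bulb :: C) = None.
Proof.
move=> vC; apply/grundy_NoneP => j; have [->|neq] := eqVneq j k.+2.
  left; exists W; [exact: quiet_bulb|exact: grundy_bulbs_socket].
right; exists (bulbs k.+1 ++ bulb :: C); first exact: remove_single_socket.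
by rewrite (grundy_bulbs_cat _ 1) // => -[]; lia.
Qed.

(** Removing the socket protects all values but [k.+1 + i]. No quiet option attains that one: [W]
    alone has value [k.+2], too small since [1 < i], and tails of value 1 or infinity give
    infinity. *)
Lemma single_socket_ge2 (C : component) (i : nat) :
    no_head_socket C -> grundy C = Some i -> 1 < i ->
  grundy (W ++ C) = Some (k.+1 + i).
Proof.
move: {2}(size C).+1 (ltnSn (size C)) => N.
elim: N C i => // N IH C i leC hC vC lti.
have eC : exists C', C = bulb :: C'.
  case: (no_head_socketP _ hC) => // eC.
  by move: vC lti; rewrite eC (grundy_bulbs 0) => -[<-].
apply/grundy_SomeP; split=> [[] [G]|j ltj].
- case/(quiet_move_catP _ _ _ hC) => [s t|s t|H mv].
  + case/esym/cat_cons_eq_cat => [[t' eW _]|[[|x s'] _ //]]; last by case: s'.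
    have [_ es lt] := bulbs_eq_cat_cons _ _ _ _ eW.
    by rewrite es grundy_bulbs => -[]; lia.
  + move=> /(bulbs_sockets_eq_cat k.+1 1) [a [b [-> -> em]]] nb.
    case: nb; have [-> ->] : a = 0 /\ b = 0 by lia.
    by case: eC => C' ->; rewrite cats0; split; rewrite // -addn1 bulbsD last_cat.
  + have hH := no_head_socket_quiet _ _ mv hC.
    have neq := quiet_grundy_neq _ _ _ vC mv.
    case: (no_head_socketP _ hH) => [->|[H' eH]].
      by rewrite cats0 grundy_bulbs_socket => -[]; lia.
    rewrite {}eH in hH mv neq *.
    case vH: (grundy (bulb :: H')) neq => [[|[|a]]|] neq.
    * by case: (grundy_bulb_cons_neq0 H').
    * by rewrite single_socket_one.
    * rewrite (IH _ a.+2) //; last by have := quiet_move_size mv; lia.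
      by case=> eai; apply: neq; congr Some; lia.
    * by rewrite single_socket_infinity.
- case/(carry_on_move_catP _ _ _ hC) => [s t|H mv].
    case/(bulbs_sockets_eq_cat k.+1 1) => a [b [-> -> em]] _; apply.
    have [-> ->] : a = 0 /\ b = 0 by lia.
    by rewrite cats0 cat0s (grundy_bulbs_cat _ i).
  apply; apply: IH => //.
  + by have := carry_on_move_size mv; lia.
  + exact: no_head_socket_carry_on mv hC.
  + exact: carry_on_grundy_eq vC mv.
- right; case: eC hC vC {leC} => C' -> hC vC.
  exists (bulbs k.+1 ++ bulb :: C'); first exact: remove_single_socket.
  by rewrite (grundy_bulbs_cat _ i) // => -[]; lia.
Qed.

Lemma single_socket_prefix : depends_on_value W /\ preserves_infinity W.
Proof.
split=> [C i hC vC|C hC vC]; last first.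
  case: (no_head_socketP _ hC) => [eC|[C' eC]].
    by rewrite eC (grundy_bulbs 0) in vC.
  by rewrite eC in vC *; exact: single_socket_infinity.
case: (no_head_socketP _ hC) => [eC|[C' eC]].
  by move: vC; rewrite eC (grundy_bulbs 0) => -[<-].
case: i vC => [|[|i]] vC.
- by rewrite eC in vC; case: (grundy_bulb_cons_neq0 C').
- rewrite eC in vC *; rewrite single_socket_one // (single_socket_one [::]) //.
  exact: (grundy_bulbs 1).
- rewrite (single_socket_ge2 _ _ hC vC) // (single_socket_ge2 _ i.+2) //.
  exact: grundy_bulbs.
Qed.

End SingleSocket.

(** * All prefixes, and the independence of shape *)

Lemma bulbs_sockets_prefix (k m : nat) :
  depends_on_value (bulbs k ++ sockets m) /\
  preserves_infinity (bulbs k ++ sockets m).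
Proof.
elim: m => [|m [IH _]]; first by rewrite cats0; exact: bulbs_prefix.
have [km|] := boolP ((k == 0) || (m.+1 != 1)); last first.
  by case: k m {IH} => [|k] [|m] // _; exact: single_socket_prefix.
apply: quiet_prefix; first exact: quiet_sockets_bulbs_sockets.
(* Whichever socket is deleted, the prefix with [m] sockets remains, so the induction hypothesis
   applies. *)
move=> s t /bulbs_sockets_eq_cat[a [b [-> -> em]]].
by rewrite -catA -socketsD (_ : a + b = m) //; lia.
Qed.

Theorem theorem10 (k m : nat) (i : value) (C C' : component)
    (hC : star_type i C) (hC' : star_type i C') :
  grundy (bulbs k ++ sockets m ++ C) = grundy (bulbs k ++ sockets m ++ C').
Proof.
have star_head D : star_type i D -> no_head_socket D.
  by case: i {hC hC'} => [[|i]|] [_]; [move=> ->|case=> t ->|case=> t ->].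
have [dep inf] := bulbs_sockets_prefix k m.
rewrite !catA; move: (star_head _ hC) (star_head _ hC') => hdC hdC'.
case: hC hC' => vC _ [vC' _]; case: i vC vC' {star_head} => [i|] vC vC'.
  (* Both sides equal the value with the canonical tail [bulbs i]. *)
  by rewrite (dep _ _ hdC vC) (dep _ _ hdC' vC').
by rewrite !inf.
Qed.
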